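(* Let $f:\mathbb R^d\to\mathbb R$ be a smooth $m$-homogeneous function, let $\ell:\mathbb R\to\mathbb R$ be smooth, and let $L=\ell\circ f$. Let $(\theta,\lambda)\in\mathbb R^d\times\mathbb R$ be a good position. Then there exists $\alpha(\theta)\in\mathbb R$ such that for every $k$ $$\langle g,u_k\rangle=\mu_k\,\alpha(\theta)\,\langle\theta,u_k\rangle,$$ where $g=\nabla L(\theta)$ and $(\mu_k,u_k)$ are the eigenvalue–eigenvector pairs of the Hessian $\nabla^2L(\theta)$.
   Context: $f$ is $m$-homogeneous ($m$ a positive integer) if $f(s\theta)=s^mf(\theta)$ for all $s\in\mathbb R$ and $\theta\in\mathbb R^d$. This is regarded as the equivariance $f(H(\theta,\lambda))=G(f(\theta),\lambda)$ with $H(\theta,\lambda)=\lambda\theta$ and $G(y,\lambda)=\lambda^my$, $\lambda\in\mathbb R$. A pair $(\theta,\lambda)$ is a good position if $\nabla_\theta H(\theta,\lambda)$ and $\nabla_yG(f(\theta),\lambda)$ are both invertible, i.e. here $\lambda\neq0$. The number $\alpha(\theta)$ is the same for all eigenpairs.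
   Formalization: The formal theorem adds the assumption that ∇²L(θ)θ = 0 implies ∇L(θ) = 0; without it the claim fails (d = m = 1, f(t) = t, ℓ = id, θ = 1), and the assumption is necessary for the conclusion. *)

(* Defs.v *)
From HB Require Import structures.
From mathcomp Require Import all_boot all_order all_algebra.
From mathcomp Require Import all_classical all_reals all_analysis.

Set Implicit Arguments.
Unset Strict Implicit.
Unset Printing Implicit Defensive.

Import Order.TTheory GRing.Theory Num.Theory.
Import numFieldNormedType.Exports.

Local Open Scope classical_set_scope.
Local Open Scope ring_scope.

(* Class C^n, then C^oo.  It is used only on finite-dimensional V ('rV[R]_d
   and R itself), where it amounts to the existence and continuity of all
   partial derivatives of order at most n. *)
Fixpoint Cn (R : realType) (V : normedModType R) (n : nat) (f : V -> R) : Prop :=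
  if n is n'.+1 then
    (forall x, differentiable f x) /\ (forall v, Cn n' (fun x => 'D_v f x))
  else continuous f.

Definition smooth (R : realType) (V : normedModType R) (f : V -> R) : Prop :=
  forall n, Cn n f.

Definition dot (R : realType) (d : nat) (u v : 'rV[R]_d) : R :=
  \sum_i u 0 i * v 0 i.

Definition partial (R : realType) (d : nat) (i : 'I_d)
    (f : 'rV[R]_d -> R) : 'rV[R]_d -> R :=
  fun x => 'D_(delta_mx 0 i) f x.

Definition gradient (R : realType) (d : nat) (f : 'rV[R]_d -> R)
    (x : 'rV[R]_d) : 'rV[R]_d :=
  \row_i partial i f x.

Definition hessian (R : realType) (d : nat) (f : 'rV[R]_d -> R)
    (x : 'rV[R]_d) : 'M[R]_d :=
  \matrix_(i, j) partial j (partial i f) x.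

(* [eigenspace] consists of row vectors u with u *m A = mu *: u; on the
   symmetric matrices considered here these are the usual eigenvectors. *)
Definition eigenpair (R : realType) (d : nat) (A : 'M[R]_d)
    (mu : R) (u : 'rV[R]_d) : Prop :=
  (u <= eigenspace A mu)%MS /\ u != 0.

Definition homogeneous (R : realType) (d m : nat) (f : 'rV[R]_d -> R) : Prop :=
  forall (s : R) (theta : 'rV[R]_d), f (s *: theta) = s ^+ m * f theta.

(* Homogeneity of f is the equivariance f (H theta lambda) = G (f theta) lambda
   with H := actH and G := actG m. *)
Definition actH (R : realType) (d : nat) (theta : 'rV[R]_d) (lambda : R) :
  'rV[R]_d := lambda *: theta.

Definition actG (R : realType) (m : nat) (y lambda : R) : R :=
  lambda ^+ m * y.

(* The output space is R, so the Jacobian of G in y is a scalar. *)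
Definition good_position (R : realType) (d : nat) (f : 'rV[R]_d -> R)
    (H : 'rV[R]_d -> R -> 'rV[R]_d) (G : R -> R -> R)
    (theta : 'rV[R]_d) (lambda : R) : Prop :=
  'J (H ^~ lambda) theta \in unitmx /\
  derive1 (G ^~ lambda) (f theta) \is a GRing.unit.

(* Main.v *)
(* Along the ray through theta, homogeneity gives
     grad L (s theta) = psi s *: grad f theta,  psi s = l' (s^m f theta) s^(m-1),
   so differentiating at s = 1 shows that the Hessian of L maps theta to
   psi' 1 *: grad f theta, while grad L theta = l' (f theta) *: grad f theta.
   Thus grad L theta = alpha *: (hessian L theta *m theta^T) with
   alpha = l' (f theta) / psi' 1; when psi' 1 = 0 the nondegeneracy hypothesis
   gives grad L theta = 0 and alpha = 0 works.  Pairing with an eigenvector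
   concludes. *)

Require Import Defs.
From mathcomp Require Import all_boot all_order all_algebra.
From mathcomp Require Import all_classical all_reals all_analysis.
Import Order.TTheory GRing.Theory Num.Theory.
Import numFieldNormedType.Exports.
Local Open Scope ring_scope.

Lemma derive_comp (R : realType) (U V W : normedModType R) (f : U -> V)
    (g : V -> W) (x v : U) :
  differentiable f x -> differentiable g (f x) ->
  'D_v (g \o f) x = 'D_('D_v f x) g (f x).
Proof.
move=> df dg; rewrite deriveE; last exact: differentiable_comp.
by rewrite diff_comp //= deriveE // deriveE.
Qed.

Lemma derive_vecZ (R : realType) (V W : normedModType R) (f : V -> W) (x v : V)
    (c : R) :
  differentiable f x -> 'D_(c *: v) f x = c *: 'D_v f x.
Proof. by move=> df; rewrite !deriveE // linearZ. Qed.

Lemma derive_comp_scalar (R : realType) (V : normedModType R) (f : V -> R)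
    (l : R -> R) (x v : V) :
  differentiable f x -> differentiable l (f x) ->
  'D_v (l \o f) x = 'D_1 l (f x) * 'D_v f x.
Proof.
(* After the chain rule, the direction ['D_v f x] in [R] is read as a multiple of the direction [1],
   whose scalar comes out by linearity. *)
move=> df dl; rewrite derive_comp // -[X in 'D_X l _]mulr1.
by rewrite [X in 'D_X _ _](_ : _ = 'D_v f x *: 1) // derive_vecZ // mulrC.
Qed.

(** Serves to read each entry of a Hessian-vector product as a directional derivative of a partial
    derivative. *)
Lemma derive_sum_partial (R : realType) (d : nat) (f : 'rV[R]_d -> R)
    (x v : 'rV[R]_d) :
  differentiable f x -> 'D_v f x = \sum_j partial j f x * v 0 j.
Proof.
move=> df; rewrite deriveE // {1}(row_sum_delta v) linear_sum.
by apply: eq_bigr => j _; rewrite linearZ /= /partial deriveE // mulrC.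
Qed.

(** The curve [s *: x] passes through [x] at [s = 1] with velocity [x], so the chain rule
    applies. *)
Lemma derive_radial (R : realType) (V W : normedModType R) (f : V -> W)
    (x : V) :
  differentiable f x -> 'D_x f x = 'D_1 (fun s : R => f (s *: x)) 1.
Proof.
move=> df.
have dx : differentiable (fun s : R => s *: x) (1 : R) by exact: differentiableZl.
have di : differentiable (@id R) (1 : R) by [].
rewrite [RHS](derive_comp _ _ _ _ _ _ _ _ dx) ?scale1r // (deriveE _ dx).
by rewrite (diffZl x di) -(deriveE _ di) derive_id /= scale1r.
Qed.

(** Differentiating [f (s *: y) = s ^+ m * f y] in [y] produces a factor [s] on the left; cancelling
    it lowers the exponent by one. *)
Lemma derive_homogeneous (R : realType) (d m : nat) (f : 'rV[R]_d -> R)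
    (s : R) (x v : 'rV[R]_d) :
  (forall y, differentiable f y) -> homogeneous m f -> s != 0 -> (0 < m)%N ->
  'D_v f (s *: x) = s ^+ m.-1 * 'D_v f x.
Proof.
move=> df hf s0 m0; apply: (mulfI s0).
have dx : derivable f x v by exact: diff_derivable.
rewrite mulrA -exprS prednK // -[RHS](deriveZ (s ^+ m) dx).
have -> : s ^+ m \*: f = f \o (fun y => s *: y).
  by apply/funext => y /=; rewrite hf.
have ds : differentiable (fun y : 'rV[R]_d => s *: y) x.
  exact: differentiableZ.
rewrite [RHS](derive_comp _ _ _ _ _ _ _ _ ds) //.
by rewrite (deriveZ s (@derivable_id _ _ x v)) derive_id derive_vecZ.
Qed.

Lemma hessian_comp_mul_radial (R : realType) (d m : nat) (f : 'rV[R]_d -> R)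
    (l : R -> R) (theta : 'rV[R]_d) :
  (0 < m)%N -> smooth f -> homogeneous m f -> smooth l ->
  exists c : R,
    hessian (l \o f) theta *m theta^T = c *: (gradient f theta)^T.
Proof.
move=> m0 sf hf sl.
have [df d2f] := sf 2%N; have [dl d2l] := sl 2%N.
have dl' y : differentiable ('D_1 l) y by case: (d2l 1).
(* For [s != 0], every partial of [l \o f] at [s *: theta] is [psi s] times that of [f] at [theta].
   As [psi] does not depend on the index, one constant serves all rows. *)
pose psi (s : R) := 'D_1 l (s ^+ m * f theta) * s ^+ m.-1.
have dpsi : derivable psi (1 : R) (1 : R).
  have dX n : differentiable (fun s : R => s ^+ n) (1 : R).
    exact/derivable1_diffP/exprn_derivable.
  apply/derivable1_diffP; apply: differentiableM; last exact: dX.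
  have dP : differentiable (fun s : R => s ^+ m * f theta) (1 : R).
    exact: (differentiableM (dX m)).
  exact: (differentiable_comp dP (dl' _)).
exists ('D_1 psi 1); apply/matrixP => i j; rewrite ord1 !mxE.
pose fi := partial i (l \o f).
have fiE x : fi x = 'D_1 l (f x) * partial i f x.
  exact: derive_comp_scalar.
have dfi : differentiable fi theta.
  rewrite (_ : fi = ('D_1 l \o f) * partial i f); last exact/funext.
  by apply: differentiableM; [exact: differentiable_comp | case: (d2f (delta_mx 0 i))].
rewrite (eq_bigr (fun j => partial j fi theta * theta 0 j)); last first.
  by move=> k _; rewrite !mxE.
rewrite -derive_sum_partial // derive_radial // [RHS]mulrC.
rewrite -[RHS](deriveZ (partial i f theta) dpsi).
(* The factorization through [psi] was obtained by cancelling [s], so it is used only for [s] near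
   1, where [s != 0]; this suffices for the derivative at 1. *)
apply: near_eq_derive; near=> s.
rewrite fiE hf /partial (derive_homogeneous _ _ m) //.
  by rewrite /psi mulrA mulrC.
near: s.
exact: (@cvgr_neq0 _ _ _ _ _ id (1 : R)).
Unshelve. all: by end_near. Qed.

Theorem corollary1 (R : realType) (d m : nat) (f : 'rV[R]_d -> R) (l : R -> R)
    (theta : 'rV[R]_d) (lambda : R) :
  (0 < m)%N ->
  smooth f ->
  homogeneous m f ->
  smooth l ->
  good_position f (@actH R d) (@actG R m) theta lambda ->
  (hessian (l \o f) theta *m theta^T = 0 -> gradient (l \o f) theta = 0) ->
  exists alpha : R,
    forall (mu : R) (u : 'rV[R]_d),
      eigenpair (hessian (l \o f) theta) mu u ->
      dot (gradient (l \o f) theta) u = mu * alpha * dot theta u.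
Proof.
move=> m0 sf hf sl _ Hg0.
have [c Hc] := hessian_comp_mul_radial _ _ _ _ _ theta m0 sf hf sl.
have [df _] := sf 1%N; have [dl _] := sl 1%N.
set g := gradient _ _ in Hg0 *; set H := hessian _ _ in Hc Hg0 *.
(* The second argument goes on the left so that [u] meets [H] as a row vector and [u *m H = mu *: u]
   applies directly. *)
have dotE (x y : 'rV[R]_d) : dot x y = (y *m x^T) 0 0.
  by rewrite mxE; apply: eq_bigr => i _; rewrite mxE mulrC.
have gE : g = 'D_1 l (f theta) *: gradient f theta.
  by apply/rowP => i; rewrite !mxE /partial derive_comp_scalar.
suff [a ga] : exists a : R, g^T = a *: (H *m theta^T).
  exists a => mu u [/eigenspaceP Hu _].
  by rewrite !dotE ga -scalemxAr mulmxA Hu -scalemxAl !mxE mulrCA mulrA.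
have [c0|c0] := eqVneq c 0.
  by exists 0; rewrite scale0r Hg0 ?trmx0 // Hc c0 scale0r.
exists ('D_1 l (f theta) / c).
by rewrite Hc scalerA divfK // gE linearZ.
Qed.
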